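(* Let $d\ge 1$ be an integer, $a>0$, $\lambda>0$ and $0<\epsilon<a/4$. Let $\omega$ be a Poisson point process on the torus $\mathbb{T}_a^d$ with intensity measure $\lambda\,dx$, and for an integer $k\ge 1$ let $N_k$ be the number of $(k-1)$-simplices of the Čech complex $\mathcal{C}_\epsilon(\omega)$ (so $N_1$ is the number of points of $\omega$). Then for every integer $n\ge 0$, $$\mathbf{E}[N_k\mid N_1=n]=\binom{n}{k}k^d\left(\frac{2\epsilon}{a}\right)^{d(k-1)}.$$
   Context: $\mathbb{T}_a^d=\mathbb{R}^d/a\mathbb{Z}^d$, identified with $X=[0,a)^d$, is equipped with Lebesgue measure and the distance $\rho_d(x,y)=\inf_{m\in\mathbb{Z}^d}\|x-y+ma\|_\infty$. For a finite set $\omega\subset\mathbb{T}_a^d$, the Čech complex $\mathcal{C}_\epsilon(\omega)$ is the abstract simplicial complex with vertex set $\omega$ in which distinct points $v_0,\dots,v_k\in\omega$ form a $k$-simplex if and only if $\bigcap_{i=0}^k B(v_i,\epsilon)\neq\emptyset$, where $B(v,\epsilon)=\{y:\rho_d(v,y)<\epsilon\}$. A Poisson point process with intensity measure $\lambda\,dx$ is a random finite set $\omega$ such that the number of points in any Borel set $A$ is Poisson with mean $\lambda|A|$, with independence over disjoint sets; conditionally on $N_1=n$, $\omega$ consists of $n$ independent uniformly distributed points on the torus (a binomial process). *)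

(* Defs.v *)
From HB Require Import structures.
From mathcomp Require Export all_boot all_order all_algebra finmap.
From mathcomp Require Export all_classical all_reals all_analysis.

Set Implicit Arguments.
Unset Strict Implicit.
Unset Printing Implicit Defensive.

Import Order.TTheory GRing.Theory Num.Theory.

Local Open Scope classical_set_scope.
Local Open Scope ring_scope.

Section Torus.
Context {R : realType} (d : nat).
Implicit Types (a eps : R) (x y v : d.-tuple R).

(* The torus R^d / a Z^d is represented by the fundamental domain [0, a[^d
   inside d.-tuple R, whose sigma-algebra is generated by the coordinates,
   i.e. is the Borel one. *)
Definition torus a : set (d.-tuple R) :=
  [set x | forall i : 'I_d, 0 <= tnth x i < a].

(* The infimum over m of the sup norm of x - y + m a. *)
Definition torus_dist a x y : R :=
  inf [set r | exists m : 'I_d -> int,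
    r = \big[Num.max/0]_(i < d) `|tnth x i - tnth y i + (m i)%:~R * a|].

Definition torus_ball a v eps : set (d.-tuple R) :=
  [set y | torus a y /\ torus_dist a v y < eps].

(* The simplices of the complex, each given as its nonempty vertex set. *)
Definition cech a eps (omega : {fset d.-tuple R}) : {fset {fset d.-tuple R}} :=
  [fset s in fpowerset omega |
    (s != fset0) &&
    `[< \bigcap_(v in [set` s]) torus_ball a v eps !=set0 >] ]%fset.

End Torus.

Definition simplices {T : choiceType} (j : nat) (K : {fset {fset T}}) :
    {fset {fset T}} :=
  [fset s in K | #|` s| == j.+1]%fset.

(* For k >= 1, the number of (k-1)-simplices. *)
Definition nb_simplices {R : realType} {d : nat} (a eps : R) (k : nat)
    (omega : {fset d.-tuple R}) : nat :=
  #|` simplices k.-1 (cech a eps omega)|.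

(* d-dimensional Lebesgue measure on Borel sets: the d-fold product of
   lebesgue_measure, transported along (x, t) |-> x :: t; for d = 0 it is the
   unit mass at the empty tuple. *)
Fixpoint lebesgue_tuple {R : realType} (d : nat) : set (d.-tuple R) -> \bar R :=
  match d with
  | 0 => fun A => \d_([tuple] : 0.-tuple R) A
  | d'.+1 => fun A => (lebesgue_measure \x @lebesgue_tuple R d')%E
               [set p : R * d'.-tuple R | A [tuple of p.1 :: p.2]]
  end.

Definition nb_points {T : choiceType} (A : set T) (omega : {fset T}) : nat :=
  #|` [fset x in omega | x \in A]%fset|.

Section Poisson.
Context {R : realType} {d : nat} {dO : measure_display}
  {Omega : measurableType dO}.

(* omega is a Poisson point process on the torus with intensity lambda dx:
   the fields say that the configurations lie in the torus, that the counts of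
   Borel sets are random variables, that they are Poisson distributed, and that
   the counts of pairwise disjoint Borel sets are mutually independent (the
   product rule for subfamilies is obtained by taking U i = setT).
   The second argument of poisson_prob is a dummy. *)
Record poisson_process (P : probability Omega R) (a lambda : R)
    (omega : Omega -> {fset d.-tuple R}) : Prop := PoissonProcess {
  pp_torus : forall w, [set` omega w] `<=` torus a;
  pp_measurable : forall A, measurable A -> A `<=` torus a ->
    measurable_fun setT (fun w => nb_points A (omega w));
  pp_poisson : forall A, measurable A -> A `<=` torus a ->
    forall U : set nat,
      P [set w | U (nb_points A (omega w))] =
      poisson_prob (lambda * fine (lebesgue_tuple A)) 0 U;
  pp_independent : forall (m : nat) (A : 'I_m -> set (d.-tuple R)),
    (forall i, measurable (A i)) -> (forall i, A i `<=` torus a) ->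
    trivIset setT A ->
    forall U : 'I_m -> set nat,
      P [set w | forall i, U i (nb_points (A i) (omega w))] =
      (\prod_(i < m) P [set w | U i (nb_points (A i) (omega w))])%E }.

(* Elementary conditional expectation E[X | E] = E[X 1_E] / P(E), meaningful
   for P(E) > 0. *)
Definition cond_expectation (P : probability Omega R) (X : Omega -> R)
    (E : set Omega) : \bar R :=
  ('E_P[X \* \1_E] / P E)%E.

End Poisson.

(* Main.v *)
From mathcomp Require Import zify ring lra perm measurable_realfun.
Require Import Defs.

Set Implicit Arguments.
Unset Strict Implicit.
Unset Printing Implicit Defensive.

Import Order.TTheory GRing.Theory Num.Theory.
Import numFieldNormedType.Exports.
Local Open Scope classical_set_scope.
Local Open Scope ring_scope.

(* Cut the torus into q^d cells.  Given N_1 = n, the Poisson law of the cell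
   counts makes the unordered family of the cells of the points that of n
   independent uniform cells.  The sup-norm balls being products of arcs, k
   points span a simplex exactly when, in each coordinate, they lie in an open
   arc of length 2 eps; up to boundary effects of a few cells, this says that
   their cells lie among l consecutive ones with l / q close to b = 2 eps / a.
   Since b < 1/2, such a cluster has a unique first cell, so that
   q (l^k - (l-1)^k) of the q^k cell families are clustered in one coordinate.
   This squeezes the expectation between two values that tend to
   C(n,k) (k b^(k-1))^d as q grows, without any measurability of N_k. *)

(** * Multinomial counting: sizes of permutation classes of tuples *)

Section Multinomial.
Local Open Scope nat_scope.
Variable C : finType.

Lemma card_tuple_cons n (Q : pred (n.+1.-tuple C)) :
  #|Q| = \sum_(x : C) #|[pred t : n.-tuple C | Q [tuple of x :: t]]|.
Proof.
pose f (u : C * n.-tuple C) : n.+1.-tuple C := [tuple of u.1 :: u.2].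
have f_bij : bijective f.
  exists (fun t => (thead t, [tuple of behead t])).
    by move=> [x t]; congr pair; apply/val_inj.
  by move=> t; rewrite /f /= -tuple_eta.
rewrite -sum1_card (reindex f) /=; last exact: onW_bij.
under [RHS]eq_bigr do rewrite -sum1_card.
rewrite pair_big_dep /=; apply: eq_bigl => -[x t].
by rewrite !unfold_in.
Qed.

(** Induction on the length: a first entry [x] lowers the multiplicity of [x] by one in the rest, so
    that [(v x)!] gives up a factor [v x]; over all [x] these factors add up to the length. The
    product form avoids division in [nat]. *)
Lemma card_tuple_count n (v : C -> nat) : \sum_c v c = n ->
  #|[pred t : n.-tuple C | [forall c, count_mem c t == v c]]| *
    \prod_c (v c)`! = n`!.
Proof.
elim: n v => [|n IHn] v sv.
  have v0 c : v c = 0.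
    by apply/eqP; rewrite -leqn0 -sv (bigD1 c) //= leq_addr.
  rewrite big1 => [|c _]; last by rewrite v0.
  rewrite muln1 (eq_card (B := predT)) ?card_tuple // => t.
  by rewrite !inE tuple0; apply/forallP => c; rewrite v0.
rewrite card_tuple_cons big_distrl /= factS -sv big_distrl /=.
apply: eq_bigr => x _.
have [vx0|vx_gt0] := posnP (v x).
  rewrite vx0 mul0n (eq_card0 (A := [pred _ | _])) // => t; rewrite !inE.
  by apply/negP => /forallP /(_ x); rewrite /= eqxx vx0.
pose v' c := v c - (c == x).
have sv' : \sum_c v' c = n.
  apply: succn_inj; rewrite -sv (bigD1 x) //= [RHS](bigD1 x) //= -addSn.
  congr (_ + _); first by rewrite /v' eqxx; lia.
  by apply: eq_bigr => c /negPf cx; rewrite /v' cx subn0.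
rewrite -(IHn v' sv') (bigD1 x) //= [in RHS](bigD1 x) //=.
have -> : \prod_(i | i != x) (v' i)`! = \prod_(i | i != x) (v i)`!.
  by apply: eq_bigr => c /negPf cx; rewrite /v' cx subn0.
have -> : (v x)`! = v x * (v' x)`!.
  by rewrite /v' eqxx subn1; case: (v x) vx_gt0.
rewrite (eq_card (B := [pred t : n.-tuple C |
  [forall c, count_mem c t == v' c]])) => [|t]; first by rewrite -!mulnA mulnCA.
rewrite !inE; apply: eq_forallb => c /=; rewrite /v' [x == c]eq_sym.
case: (eqVneq c x) => [->|_]; last by rewrite subn0.
lia.
Qed.

Lemma sum_count_mem_tuple n (t : n.-tuple C) : \sum_c count_mem c t = n.
Proof.
rewrite -[RHS](size_tuple t) -sum1_size.
under eq_bigr => c _ do rewrite -sum1_count big_mkcond.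
rewrite exchange_big /=; apply: eq_bigr => x _.
by rewrite -big_mkcond /= (eq_bigl (pred1 x)) ?big_pred1_eq.
Qed.

Lemma card_perm_eq n (t : n.-tuple C) :
  #|[pred t' : n.-tuple C | perm_eq t t']| * \prod_c (count_mem c t)`! = n`!.
Proof.
rewrite -(card_tuple_count (n := n) (v := fun c => count_mem c t)).
  congr (_ * _); apply: eq_card => t'; rewrite !inE perm_sym /perm_eq.
  apply/allP/forallP => /= h c; last by move=> _; exact: h.
  have [|] := boolP (c \in t' ++ t); first exact: h.
  rewrite mem_cat negb_or => /andP[ct' ct].
  by rewrite !(count_memPn _).
exact: sum_count_mem_tuple.
Qed.

End Multinomial.

(** * Clusters of consecutive cells on a cycle and their enumeration *)

Section Clusters.
Local Open Scope nat_scope.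

(** The number of forward steps from [c] to [c'] around the cycle; adding [p] first keeps the
    truncated subtraction exact. *)
Definition cyclic_offset p (c c' : 'I_p) : nat := (c' + p - c) %% p.

(** The first cell of the window has to be occupied. A nonempty family within [l] consecutive cells
    always satisfies this once the window is moved up to its earliest occupied cell. *)
Definition clustered n p l (A : {set 'I_n}) (h : 'I_n -> 'I_p) : bool :=
  [exists i0 in A, forall i in A, cyclic_offset (h i0) (h i) < l].

Lemma eq_clustered n p l (A : {set 'I_n}) (h h' : 'I_n -> 'I_p) :
  h =1 h' -> clustered l A h = clustered l A h'.
Proof.
move=> hh; apply: eq_existsb => i0; congr andb.
by apply: eq_forallb => i; rewrite !hh.
Qed.

Lemma card_cyclic_offset_lt p l (c : 'I_p) : l <= p ->
  #|[pred c' | cyclic_offset c c' < l]| = l.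
Proof.
move=> lp; have p0 : 0 < p by apply: leq_ltn_trans (ltn_ord c).
pose f (i : 'I_l) : 'I_p := Ordinal (ltn_pmod (c + i) p0).
have ofs (i : 'I_l) : cyclic_offset c (f i) = i.
  rewrite /cyclic_offset /f /=; have := ltn_ord c; have := ltn_ord i => il cp.
  have [h|h] := ltnP (c + i) p.
    by rewrite (modn_small h) -addnA addnC addnK modnDr modn_small; lia.
  have -> : (c + i) %% p = c + i - p by rewrite -{1}(subnK h) modnDr modn_small; lia.
  by rewrite modn_small; lia.
have f_inj : injective f.
  by move=> i j /(congr1 (cyclic_offset c)); rewrite !ofs => /val_inj.
rewrite -[RHS]card_ord -(card_codom f_inj); apply: eq_card => c'; rewrite !inE.
apply/idP/codomP => [h|[i ->]]; last by rewrite ofs.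
exists (Ordinal h); apply/val_inj; rewrite /= /cyclic_offset.
have := ltn_ord c; have := ltn_ord c' => c'p cp.
have [le|lt] := leqP c c'.
  have -> : c' + p - c = c' - c + p by lia.
  by rewrite modnDr (modn_small (m := c' - c)); [rewrite subnKC // modn_small|lia].
rewrite (modn_small (m := c' + p - c)); last lia.
have -> : c + (c' + p - c) = c' + p by lia.
by rewrite modnDr modn_small.
Qed.

Lemma cyclic_offset_eq0 p (c c' : 'I_p) : (cyclic_offset c c' == 0) = (c' == c).
Proof.
have := ltn_ord c; have := ltn_ord c' => c'p cp.
rewrite -val_eqE /= /cyclic_offset.
have [le|lt] := leqP c c'.
  have -> : c' + p - c = c' - c + p by lia.
  by rewrite modnDr modn_small; lia.
by rewrite modn_small; lia.
Qed.

(** Walking from [c] to [c'] and on to [c] again winds exactly once around the cycle. *)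
Lemma cyclic_offset_sym p (c c' : 'I_p) :
  c != c' -> cyclic_offset c c' + cyclic_offset c' c = p.
Proof.
have := ltn_ord c; have := ltn_ord c' => c'p cp.
have key (x y : 'I_p) : x < y -> cyclic_offset x y + cyclic_offset y x = p.
  move=> xy; rewrite /cyclic_offset; have := ltn_ord y => yp.
  have -> : y + p - x = y - x + p by lia.
  by rewrite modnDr !modn_small; lia.
rewrite -val_eqE /= neq_ltn => /orP[/key //|/key].
by rewrite addnC.
Qed.

Lemma card_ffun_in n p (A : {set 'I_n}) (Q : pred 'I_p) :
  #|[pred h : {ffun 'I_n -> 'I_p} | [forall i in A, Q (h i)]]| =
  #|Q| ^ #|A| * p ^ (n - #|A|).
Proof.
pose F (i : 'I_n) : pred 'I_p := fun c => (i \in A) ==> Q c.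
have -> : #|[pred h : {ffun 'I_n -> 'I_p} | [forall i in A, Q (h i)]]| = #|family F|.
  by apply: eq_card => h; rewrite !inE.
rewrite card_family foldrE big_map enumT -/(index_enum _) (bigID (mem A)) /=.
congr (_ * _).
  rewrite -prod_nat_const; apply: eq_bigr => i iA; apply: eq_card => c.
  by rewrite -[LHS]/((i \in A) ==> Q c) iA.
rewrite (eq_bigr (fun=> p)) => [|i iA]; last first.
  rewrite -[RHS]card_ord; apply: eq_card => c.
  by rewrite -[LHS]/((i \in A) ==> Q c) (negPf iA).
rewrite prod_nat_const; congr (_ ^ _).
have := cardsC A; rewrite card_ord => cA.
transitivity #|~: A|; first by apply: eq_card => i; rewrite !inE.
by rewrite -(addKn #|A| #|~: A|) cA.
Qed.

(* A clustered family has a unique first cell: two of them would have offsets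
   below [l] adding up to [p]. *)
Lemma card_clustered n p l (A : {set 'I_n}) : l.*2 <= p -> 0 < #|A| ->
  #|[pred h : {ffun 'I_n -> 'I_p} | clustered l A h]| =
  p * (l ^ #|A| - l.-1 ^ #|A|) * p ^ (n - #|A|).
Proof.
move=> lp A0.
pose start (c : 'I_p) (h : {ffun 'I_n -> 'I_p}) :=
  [forall i in A, cyclic_offset c (h i) < l] && [exists i in A, h i == c].
have startE (h : {ffun 'I_n -> 'I_p}) : clustered l A h = \sum_c start c h :> nat.
  have [/exists_inP[i0 i0A /forall_inP hl]|nc] := boolP (clustered l A h).
    rewrite (bigD1 (h i0)) //= big1 => [|c ch]; last first.
      apply/eqP; rewrite eqb0; apply/negP => /andP[/forall_inP /(_ _ i0A) h1].
      move=> /exists_inP[i iA /eqP hic]; have := hl i iA; rewrite hic => h2.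
      by have := cyclic_offset_sym ch; lia.
    rewrite addn0; apply/esym/eqP; rewrite eqb1; apply/andP; split.
      by apply/forall_inP.
    by apply/exists_inP; exists i0.
  rewrite big1 // => c _; apply/eqP; rewrite eqb0; apply/negP => /andP[hl].
  move=> /exists_inP[i0 i0A /eqP hc]; move/negP: nc; apply.
  by apply/exists_inP; exists i0 => //; rewrite hc.
have cardS c : #|[pred h | start c h]| =
    (l ^ #|A| - l.-1 ^ #|A|) * p ^ (n - #|A|).
  pose Q l' := [pred c' | cyclic_offset c c' < l'].
  pose Q' := [pred c' | 0 < cyclic_offset c c' < l].
  pose FQ (Q : pred 'I_p) := [pred h : {ffun 'I_n -> 'I_p} | [forall i in A, Q (h i)]].
  have cQ : #|Q l| = l by apply: card_cyclic_offset_lt; lia.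
  have cQ' : #|Q'| = l.-1.
    case: l lp @Q @Q' cQ {startE start} => [|l] lp Q Q' cQ.
      by apply: eq_card0 => c'; rewrite !inE ltn0 andbF.
    have c0 : cyclic_offset c c = 0 by apply/eqP; rewrite cyclic_offset_eq0.
    transitivity #|Q l.+1|.-1; last by rewrite cQ.
    rewrite [in RHS](cardD1 c) inE c0 ltnS leq0n add1n succnK.
    by apply: eq_card => c'; rewrite !inE lt0n cyclic_offset_eq0.
  (* A family starts at [c] when its offsets from [c] are all below [l] but not all positive; hence
     a difference of two powers. *)
  have : #|FQ (Q l)| = #|FQ Q'| + #|[pred h | start c h]|.
    rewrite -(cardID (FQ Q') (FQ (Q l))); congr (_ + _); apply: eq_card => h.
      rewrite !inE andbC; apply/andb_idr => /forall_inP hh.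
      by apply/forall_inP => i /hh /andP[].
    rewrite !inE /start andbC.
    have [/forall_inP hl|//] := boolP [forall i in A, cyclic_offset c (h i) < l].
    rewrite negb_forall_in; apply: eq_existsb => i.
    have [iA|//] := boolP (i \in A).
    by rewrite /= negb_and (hl i iA) orbF lt0n negbK cyclic_offset_eq0.
  by rewrite /FQ !card_ffun_in cQ cQ' mulnBl => ->; rewrite addKn.
transitivity (\sum_(h : {ffun 'I_n -> 'I_p}) \sum_c (start c h : nat)).
  rewrite -sum1_card big_mkcond /=; apply: eq_bigr => h _.
  by rewrite -startE inE; case: clustered.
rewrite exchange_big /=.
rewrite (eq_bigr (fun=> (l ^ #|A| - l.-1 ^ #|A|) * p ^ (n - #|A|))) => [|c _].
  by rewrite sum_nat_const card_ord mulnA.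
rewrite -(cardS c) -sum1_card [RHS]big_mkcond; apply: eq_bigr => h _.
by rewrite inE; case: (start c h).
Qed.

Section Subsets.
Variables (d p n k l : nat).
Local Notation cell := {ffun 'I_d -> 'I_p}.

Definition clustered_subsets (t : n.-tuple cell) : {set {set 'I_n}} :=
  [set A : {set 'I_n} | (#|A| == k) &&
    [forall j, clustered l A (fun i => tnth t i j)]].

(** A permutation of the indices maps clustered subsets injectively to clustered subsets, and so
    does its inverse. Cell counts know the cells only up to order, so this invariance lets them
    determine the number of clustered subsets. *)
Lemma card_clustered_subsets_perm (t t' : n.-tuple cell) : perm_eq t t' ->
  #|clustered_subsets t| = #|clustered_subsets t'|.
Proof.
suff le (u u' : n.-tuple cell) :
    perm_eq u u' -> #|clustered_subsets u| <= #|clustered_subsets u'|.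
  by move=> tt'; apply/eqP; rewrite eqn_leq !le // perm_sym.
move=> /tuple_permP[s us].
have {}us i : tnth u i = tnth u' (s i).
  by rewrite (_ : u = [tuple tnth u' (s i) | i < n]) ?tnth_mktuple //;
     apply: val_inj.
have s_inj : injective (fun A : {set 'I_n} => s @: A).
  by apply: imset_inj; exact: perm_inj.
rewrite -(card_imset _ s_inj).
apply/subset_leq_card/fintype.subsetP => _ /imsetP[A + ->].
rewrite !inE card_imset; last exact: perm_inj.
move=> /andP[-> /forallP cl]; apply/forallP => j.
have /exists_inP[i0 i0A /forall_inP hl] := cl j.
apply/exists_inP; exists (s i0); first exact: imset_f.
by apply/forall_inP => _ /imsetP[i iA ->]; rewrite -!us; exact: hl.
Qed.

(** After exchanging the sums, each [A] of size [k] contributes the tuples clustered on [A]; the [d]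
    coordinates vary independently, which gives the [d]-th power of the count in
    [card_clustered]. *)
Lemma sum_card_clustered_subsets : l.*2 <= p -> 0 < k ->
  \sum_t #|clustered_subsets t| =
  'C(n, k) * (p * (l ^ k - l.-1 ^ k) * p ^ (n - k)) ^ d.
Proof.
move=> lp k0.
transitivity (\sum_(A : {set 'I_n} | #|A| == k)
    #|[pred t : n.-tuple cell | [forall j, clustered l A (fun i => tnth t i j)]]|).
  under eq_bigr do rewrite -sum1_card big_mkcond.
  rewrite exchange_big [RHS]big_mkcond /=; apply: eq_bigr => A _.
  case: ifP => Ak.
    rewrite -sum1_card [in RHS]big_mkcond.
    by apply: eq_bigr => t _; rewrite !inE Ak.
  by rewrite big1 // => t _; rewrite inE Ak.
rewrite (eq_bigr (fun=> (p * (l ^ k - l.-1 ^ k) * p ^ (n - k)) ^ d)) => [|A /eqP Ak].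
  rewrite sum_nat_cond_const; congr (_ * _).
  by rewrite -[X in 'C(X, _)]card_ord -card_draws cardsE.
(* Transposition: one family of positions per coordinate is turned into one cell per index. *)
pose f (g : {ffun 'I_d -> {ffun 'I_n -> 'I_p}}) : n.-tuple cell :=
  [tuple [ffun j => g j i] | i < n].
have f_bij : bijective f.
  exists (fun t : n.-tuple cell => [ffun j => [ffun i => tnth t i j]]).
    by move=> g; apply/ffunP => j; apply/ffunP => i; rewrite !ffunE tnth_mktuple ffunE.
  move=> t; apply: eq_from_tnth => i; rewrite tnth_mktuple.
  by apply/ffunP => j; rewrite !ffunE.
rewrite -Ak -(card_clustered lp) ?Ak //.
rewrite -[d in RHS]card_ord -card_ffun_on -sum1_card (reindex f) /=; last exact: onW_bij.
rewrite -sum1_card; apply: eq_bigl => g; rewrite !inE.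
have cl j : clustered l A (fun i => tnth (f g) i j) = clustered l A (g j).
  by apply: eq_clustered => i; rewrite tnth_mktuple ffunE.
by apply/forallP/ffun_onP => h j; have := h j; rewrite inE cl.
Qed.

End Subsets.

End Clusters.

(** * Arcs of the circle and clusters of grid cells *)

Lemma cyclic_offset_int p (c c0 : 'I_p) (D : nat) (e : int) : (D < p)%N ->
  D%:Z = c%:Z - c0%:Z + e * p%:Z -> cyclic_offset c0 c = D.
Proof.
rewrite /cyclic_offset; have := ltn_ord c; have := ltn_ord c0.
move: (c : nat) (c0 : nat) => {c c0} c c0 c0p cp Dp h.
(* Since [D] and [c0] are below [p], [e] is at most 1; then [c + p - c0 = (1 - e) * p + D] is a
   Euclidean division with remainder [D]. *)
have q0 : 0 <= 1 - e by rewrite leNgt; apply/negP => q0; nia.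
have [q qE] : exists q : nat, q%:Z = 1 - e by exists `|1 - e|%N; rewrite gez0_abs.
have eE : e = 1 - q%:Z by lia.
have -> : (c + p - c0 = q * p + D)%N by subst e; nia.
by rewrite modnMDl modn_small.
Qed.

Section Geometry.
Context {R : realType}.
Implicit Types (a eps w y : R).

Lemma torus_dist_lt d a eps (x y : d.-tuple R) : 0 < eps ->
  torus_dist a x y < eps <-> exists m : 'I_d -> int,
    forall j, `|tnth x j - tnth y j + (m j)%:~R * a| < eps.
Proof.
move=> eps0; split=> [/inf_lt[|_ [m ->] /bigmax_ltP[_ hm]]|[m hm]].
- by eexists; exists (fun=> 0); reflexivity.
- by exists m => j; exact: hm.
- have /le_lt_trans : \big[Num.max/0]_(j < d)
      `|tnth x j - tnth y j + (m j)%:~R * a| < eps by apply/bigmax_ltP.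
  apply; rewrite /torus_dist; apply: ge_inf; last by exists m.
  exists 0 => _ [m' ->]; elim/big_ind: _ => // u v u0 v0.
  by rewrite le_max u0.
Qed.

(** Meant for nonnegative [y] below [p.+1%:R * w]; above this range [inord] falls back to cell 0. *)
Definition grid_cell p w y : 'I_p.+1 := inord (Num.truncn (y / w)).

Lemma grid_cellE p w y (c : 'I_p.+1) : 0 < w -> 0 <= y < p.+1%:R * w ->
  (grid_cell p w y == c) = (c%:R * w <= y < c.+1%:R * w).
Proof.
move=> w0 /andP[y0 yp]; have yw0 : 0 <= y / w by rewrite divr_ge0 // ltW.
rewrite -ler_pdivlMr // -ltr_pdivrMr // -truncn_eq // -val_eqE /= inordK //.
by rewrite truncn_lt_nat // ltr_pdivrMr.
Qed.

Section Circle.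
Variables (p n : nat) (w : R).
Local Notation a := (p.+1%:R * w).
Hypothesis w0 : 0 < w.
Variables (u : 'I_n -> R) (A : {set 'I_n}).
Hypothesis ua : forall i, 0 <= u i < a.

Let cellP i : (grid_cell p w (u i))%:R * w <= u i <
  (grid_cell p w (u i)).+1%:R * w.
Proof. by rewrite -grid_cellE. Qed.

(** Lifted to the line by [z], the points lie in an interval of length [2 * eps], and the leftmost
    lift provides the first cell. Passing from points to left ends of cells costs less than one
    mesh, whence the extra [w]. *)
Lemma arc_clustered l eps y (z : 'I_n -> int) : (0 < #|A|)%N ->
  (l <= p.+1)%N -> 2 * eps + w <= l%:R * w ->
  (forall i, i \in A -> `|u i - y + (z i)%:~R * a| < eps) ->
  clustered l A (fun i => grid_cell p w (u i)).
Proof.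
move=> /card_gt0P[i1 i1A] lp hl hz.
pose v i := u i + (z i)%:~R * a.
have [i0 i0A v_min] : exists2 i0, i0 \in A & forall i, i \in A -> v i0 <= v i.
  by case: (arg_minP v i1A) => i0; exists i0.
apply/exists_inP; exists i0 => //; apply/forall_inP => i iA.
have /andP[ci1 ci2] := cellP i; have /andP[ci01 ci02] := cellP i0.
have := hz i iA; have := hz i0 i0A; rewrite !ltr_norml.
move=> /andP[h01 h02] /andP[h1 h2]; have := v_min i iA; rewrite /v => vm.
set c := grid_cell p w (u i) in ci1 ci2 *; set c0 := grid_cell p w (u i0) in ci01 ci02 *.
(* [D] is the difference of the lifted cell indices, an integer that the next steps place strictly
   between -1 and [l]. *)
have [D DE] : exists D : int, D = c%:Z - c0%:Z + (z i - z i0) * p.+1%:Z.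
  by eexists.
have DEw : D%:~R * w = c%:R * w + (z i)%:~R * a - c0%:R * w - (z i0)%:~R * a :> R.
  by rewrite DE !(rmorphD, rmorphB, rmorphM) /=; ring.
have D1 : -1 < D.
  rewrite -(ltr_int R) -(ltr_pM2r w0) DEw; move: ci2; rewrite -natr1; lra.
have Dl : D < l%:Z.
  rewrite -(ltr_int R) -(ltr_pM2r w0) DEw; move: ci02; rewrite -natr1; lra.
case: D DE {DEw} D1 Dl => // D DE _ Dl.
rewrite (@cyclic_offset_int _ _ _ D (z i - z i0)) //; exact: leq_trans lp.
Qed.

Lemma clustered_arc l eps : l%:R * w < 2 * eps ->
  clustered l A (fun i => grid_cell p w (u i)) ->
  exists2 y, 0 <= y < a &
    forall i, i \in A -> exists z : int, `|u i - y + z%:~R * a| < eps.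
Proof.
have a0 : 0 < a by rewrite mulr_gt0.
move=> hl /exists_inP[i0 i0A /forall_inP hc].
(* [y0] is the midpoint of the block of [l] cells starting at [c0], whose half-length is below
   [eps]; [f] brings it back to the fundamental domain. *)
pose c0 := grid_cell p w (u i0); pose y0 := c0%:R * w + l%:R * w / 2.
pose f := Num.floor (y0 / a).
have /andP[f1 f2] : f%:~R * a <= y0 < (f + 1)%:~R * a.
  by rewrite -ler_pdivlMr // -ltr_pdivrMr // floor_itv.
exists (y0 - f%:~R * a); first by move: f2; rewrite rmorphD /=; lra.
move=> i /hc; rewrite /cyclic_offset -/c0; have /andP[] := cellP i.
set c := grid_cell p w (u i) => ci1 ci2 off.
(* [t] is 1 when [c0 <= c], and 0 when the block passes the origin before reaching [c]; hence the
   shift by [1 - t], corrected by [f]. *)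
pose t := ((c + p.+1 - c0) %/ p.+1)%N; pose o := ((c + p.+1 - c0) %% p.+1)%N.
have e : c%:R + p.+1%:R = c0%:R + t%:R * p.+1%:R + o%:R :> R.
  rewrite -natrM -!natrD; congr _%:R; have := divn_eq (c + p.+1 - c0) p.+1.
  have := ltn_ord c0; rewrite -/t -/o; lia.
exists (1 - t%:Z - f); rewrite !(rmorphD, rmorphB) /=.
have ew : c%:R * w + p.+1%:R * w = c0%:R * w + t%:R * (p.+1%:R * w) + o%:R * w.
  by rewrite -mulrDl e; ring.
have ol : o%:R * w + w <= l%:R * w.
  by rewrite -[X in _ + X]mul1r -mulrDl ler_pM2r // natr1 ler_nat.
have o0 : 0 <= o%:R * w by rewrite mulr_ge0 // ltW.
move: ci2; rewrite -natr1 /y0 ltr_norml => ci2; apply/andP; split; lra.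
Qed.

End Circle.
End Geometry.

(** * Boxes and their Lebesgue measure *)

Section Boxes.
Context {R : realType}.

Definition box d (lo : 'I_d -> R) (s : R) : set (d.-tuple R) :=
  [set x | forall i, lo i <= tnth x i < lo i + s].

Lemma measurable_box d (lo : 'I_d -> R) s : measurable (box lo s).
Proof.
have -> : box lo s = \bigcap_(i in [set: 'I_d])
    ((fun x : d.-tuple R => tnth x i) @^-1` `[lo i, lo i + s[).
  apply/seteqP; split => x /= h i => [_|]; first by rewrite /= in_itv /=; exact: h.
  by have := h i I; rewrite /= in_itv.
apply: fin_bigcap_measurable => // i _; rewrite -[X in measurable X]setTI.
by apply: (measurable_tnth i) => //; exact: measurable_itv.
Qed.

Lemma lebesgue_tuple0 d : lebesgue_tuple (set0 : set (d.-tuple R)) = 0%E.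
Proof.
elim: d => [|d IHd] /=; first by rewrite measure0.
rewrite /product_measure1 integral0_eq // => x _ /=.
by rewrite (_ : xsection _ x = set0) //; apply/seteqP; split => t; rewrite /xsection //= inE.
Qed.

(** Slices along the first coordinate are boxes of one dimension less over an interval of length [s]
    and empty elsewhere, so each dimension contributes a factor [s]. *)
Lemma lebesgue_tuple_box d (lo : 'I_d -> R) s : 0 <= s ->
  lebesgue_tuple (box lo s) = (s ^+ d)%:E.
Proof.
move=> s0; elim: d lo => [|d IHd] lo /=.
  rewrite diracE mem_set //; by case.
pose lo' (i : 'I_d) := lo (lift ord0 i).
rewrite /product_measure1.
transitivity (\int[lebesgue_measure]_x ((s ^+ d)%:E * (\1_`[lo ord0, lo ord0 + s[ x)%:E))%E.
  apply: eq_integral => x _; rewrite indicE mem_setE in_itv /=.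
  have [hx|hx] := boolP (lo ord0 <= x < lo ord0 + s).
    rewrite mule1 -(IHd lo'); congr lebesgue_tuple.
    apply/seteqP; split => t; rewrite /xsection /= ?inE /= => h i.
      by have := h (lift ord0 i); rewrite tnthS.
    case: (unliftP ord0 i) => [j ->|-> //]; rewrite tnthS; exact: h.
  rewrite mule0 (_ : xsection _ _ = set0) ?lebesgue_tuple0 //.
  apply/seteqP; split => t //; rewrite /xsection /= inE /= => /(_ ord0).
  by rewrite (negPf hx).
rewrite ge0_integralZl //; last 2 first.
- by apply/measurable_EFinP; exact: measurable_indic.
- by rewrite lee_fin exprn_ge0.
rewrite integral_indic ?setIT //= lebesgue_measure_itv /= lte_fin ltrDl.
rewrite exprSr EFinM; congr (_ * _)%E; case: ltP => [_|s0'].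
  by rewrite -EFinD addrAC subrr add0r.
by congr _%:E; apply/esym/le_anti; rewrite s0 s0'.
Qed.

(* [ge0_le_integral] asks for measurability, but the integral of a nonnegative
   function is by definition a supremum over the simple functions below it. *)
Lemma le_integral_nonmeasurable d (T : measurableType d)
    (mu : {measure set T -> \bar R})
    (f g : T -> \bar R) : (forall x, 0 <= f x)%E -> (forall x, f x <= g x)%E ->
  (\int[mu]_x f x <= \int[mu]_x g x)%E.
Proof.
move=> f0 fg; have g0 x : (0 <= g x)%E by apply: le_trans (fg x).
rewrite !ge0_integralTE //; apply: le_ereal_sup => _ [h hf <-].
by exists h => // x; apply: le_trans (hf x) (fg x).
Qed.

End Boxes.

Lemma nb_pointsE {T : choiceType} (A : set T) (omega : {fset T}) :
  nb_points A omega = count (fun x => x \in A) omega.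
Proof. by rewrite /nb_points card_fset_sum1 big_fset /= sum1_count. Qed.

(** * The grid of cells on the torus *)

Section Grid.
Context {R : realType} {d : nat}.
Variables (a : R) (p : nat).
Hypothesis a0 : 0 < a.
Local Notation cell := {ffun 'I_d -> 'I_p.+1}.

Definition mesh : R := a / p.+1%:R.

Lemma mesh_gt0 : 0 < mesh. Proof. by rewrite divr_gt0. Qed.

Lemma meshE : p.+1%:R * mesh = a.
Proof. by rewrite /mesh mulrC divfK // pnatr_eq0. Qed.

Definition cell_of (x : d.-tuple R) : cell :=
  [ffun j => grid_cell p mesh (tnth x j)].

Definition cell_set (c : cell) : set (d.-tuple R) :=
  [set x | torus a x /\ cell_of x = c].

(** This form gives the cells their measurability and their common volume. *)
Lemma cell_setE c : cell_set c = box (fun j => (c j)%:R * mesh) mesh.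
Proof.
have bnd j : (c j)%:R * mesh + mesh = (c j).+1%:R * mesh :> R.
  by rewrite -natr1 mulrDl mul1r.
apply/seteqP; split => [x [tx cx] j|x hx].
  rewrite bnd -grid_cellE ?mesh_gt0 ?meshE //; first by rewrite -cx ffunE.
have tx : torus a x.
  move=> j; have /andP[h1 h2] := hx j; apply/andP; split.
    by apply: le_trans h1; rewrite mulr_ge0 // ltW // mesh_gt0.
  apply: (lt_le_trans h2); rewrite bnd -meshE ler_pM2r ?mesh_gt0 // ler_nat.
  exact: ltn_ord.
split=> //; apply/ffunP => j; rewrite ffunE; apply/eqP.
by rewrite grid_cellE ?mesh_gt0 ?meshE // -bnd.
Qed.

Lemma torusE : @torus R d a = box (fun=> 0) a.
Proof. by apply/seteqP; split => x hx j; have := hx j; rewrite add0r. Qed.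

End Grid.

(** * The law of the cell counts and averages over permutation classes *)

Section CountLaw.
Context {R : realType} {d : nat} {dO : measure_display} {Omega : measurableType dO}.
Variables (P : probability Omega R) (a lambda : R).
Variable (omega : Omega -> {fset d.-tuple R}).
Hypotheses (a0 : 0 < a) (lambda0 : 0 < lambda).
Hypothesis homega : poisson_process P a lambda omega.
Variables (p n : nat).
Local Notation cell := {ffun 'I_d -> 'I_p.+1}.

Lemma poisson_prob1 (r : R) (m j : nat) : 0 < r ->
  poisson_prob r m [set j] = (poisson_pmf r j)%:E.
Proof.
by move=> r0; rewrite /poisson_prob r0 esum_set1 // lee_fin poisson_pmf_ge0.
Qed.

Lemma prob_nb_points A s j : 0 < s -> measurable A -> A `<=` torus a ->
  lebesgue_tuple A = (s ^+ d)%:E ->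
  P [set w | nb_points A (omega w) = j] = (poisson_pmf (lambda * s ^+ d) j)%:E.
Proof.
move=> s0 mA Aa lA; have := pp_poisson homega mA Aa [set j].
by rewrite lA /= poisson_prob1 // mulr_gt0 // exprn_gt0.
Qed.

Lemma measurable_nb_points A j : measurable A -> A `<=` torus a ->
  measurable [set w | nb_points A (omega w) = j].
Proof.
move=> mA Aa; have := pp_measurable homega mA Aa.
by move=> /(_ measurableT [set j] I); rewrite setTI.
Qed.

Definition count_event (t : n.-tuple cell) : set Omega :=
  [set w | forall c, nb_points (cell_set a c) (omega w) = count_mem c t].

Let cell_torus (c : cell) : cell_set a c `<=` torus a.
Proof. by move=> x []. Qed.

Let mcell (c : cell) : measurable (cell_set a c).
Proof. by rewrite cell_setE //; exact: measurable_box. Qed.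

Lemma measurable_count_event t : measurable (count_event t).
Proof.
have -> : count_event t = \bigcap_(c in [set: cell])
    [set w | nb_points (cell_set a c) (omega w) = count_mem c t].
  by apply/seteqP; split => w h c; [move=> _; exact: h|exact: h].
apply: fin_bigcap_measurable => // c _.
by apply: measurable_nb_points.
Qed.

Definition total_pmf : R := poisson_pmf (lambda * a ^+ d) n.

Lemma total_pmf_gt0 : 0 < total_pmf.
Proof.
have l0 : 0 < lambda * a ^+ d by rewrite mulr_gt0 // exprn_gt0.
by rewrite /total_pmf /poisson_pmf l0 !mulr_gt0 ?exprn_gt0 ?invr_gt0 ?expR_gt0 // ltr0n fact_gt0.
Qed.

(** The cells have equal volume and the counts add up to [n], so the exponentials and powers of the
    independent Poisson weights combine into those of mean [lambda * a ^+ d]. The factorials form a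
    multinomial coefficient, which by [card_perm_eq] is the size of the class of [t]. *)
Lemma prob_count_event t : P (count_event t) =
  (total_pmf * #|[pred t' : n.-tuple cell | perm_eq t t']|%:R /
   #|{: cell}|%:R ^+ n)%:E.
Proof.
pose A (i : 'I_#|{: cell}|) := cell_set a (enum_val i).
pose U (i : 'I_#|{: cell}|) := [set count_mem (enum_val i) t].
have -> : count_event t = [set w | forall i, U i (nb_points (A i) (omega w))].
  apply/seteqP; split => [w h i|w h c]; first exact: h.
  by have := h (enum_rank c); rewrite /U /A enum_rankK.
rewrite (pp_independent homega); last 3 first.
- by move=> i; exact: mcell.
- by move=> i; exact: cell_torus.
- move=> i j _ _ [x [[_ ci] [_ cj]]].
  by apply: enum_val_inj; rewrite -ci -cj.
pose mu := lambda * mesh a p ^+ d.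
have mu0 : 0 < mu by rewrite mulr_gt0 // exprn_gt0 // mesh_gt0.
rewrite (eq_bigr (fun i => (poisson_pmf mu (count_mem (enum_val i) t))%:E)) => [|i _].
  rewrite -(@big_enum_val _ _ _ _ _ (fun c => (poisson_pmf mu (count_mem c t))%:E)) /=.
  rewrite prodEFin; congr _%:E.
  have la : lambda * a ^+ d = #|{: cell}|%:R * mu.
    rewrite card_ffun !card_ord natrX /mu mulrCA -exprMn; congr (_ * _).
    by rewrite meshE.
  clearbody mu.
  have M0 : 0 < #|{: cell}|%:R * mu by rewrite -la mulr_gt0 // exprn_gt0.
  have K : #|[pred t' : n.-tuple cell | perm_eq t t']|%:R =
      n`!%:R * \prod_c ((count_mem c t)`!%:R)^-1 :> R.
    rewrite -(card_perm_eq t) natrM natr_prod prodfV mulfK //.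
    by rewrite prodf_seq_neq0; apply/allP => c _; rewrite pnatr_eq0 -lt0n fact_gt0.
  rewrite /total_pmf /poisson_pmf la M0 mu0 K !big_split /=.
  rewrite prodrXr sum_count_mem_tuple prodr_const -expRM_natl mulrN.
  have n0 : n`!%:R != 0 :> R by rewrite pnatr_eq0 -lt0n fact_gt0.
  have M1 : #|{: cell}|%:R ^+ n != 0 :> R.
    by rewrite expf_neq0 //; apply: contraTneq M0 => ->; rewrite mul0r ltxx.
  have cE : #|(xpredT : pred cell)| = #|{: cell}| by apply: eq_card.
  rewrite cE exprMn.
  move: (\prod_(i in _) _) (expR _) (_ ^+ _) (n`!%:R) M1 n0 => u v M N M1 n0.
  by field; rewrite M1 n0.
rewrite -(@prob_nb_points (A i)) ?mesh_gt0 //; [exact: mcell|exact: cell_torus|].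
by rewrite /A cell_setE // lebesgue_tuple_box // ltW // mesh_gt0.
Qed.

(** All points lie in the torus, so each is counted in exactly one cell, and equal counts mean equal
    multisets of cells. *)
Lemma count_eventE t w :
  count_event t w <-> perm_eq t (map (cell_of a p) (omega w)).
Proof.
have cE c : nb_points (cell_set a c) (omega w) =
    count_mem c (map (cell_of a p) (omega w)).
  rewrite nb_pointsE count_map; apply: eq_in_count => x xw.
  rewrite /=; apply/idP/eqP => [|xc]; rewrite inE; first by case.
  by split => //; exact: (pp_torus homega xw).
split=> [h|/permP h c]; last by rewrite cE h.
rewrite /perm_eq; apply/allP => c _ /=.
by rewrite -h cE.
Qed.

Variable S : n.-tuple cell -> nat.
Hypothesis S_perm : forall t t' : n.-tuple cell, perm_eq t t' -> S t = S t'.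

(* Dividing by the size of the permutation class of [t] compensates for the
   fact that the events [count_event t] coincide on such a class. *)
Definition class_average w : R :=
  \sum_t (S t)%:R / #|[pred t' : n.-tuple cell | perm_eq t t']|%:R *
    \1_(count_event t) w.

(** Exactly the tuples in the class of [t0] have an event containing [w], and each contributes
    [S t0] divided by the class size. *)
Lemma class_average_tuple w (x : n.-tuple (d.-tuple R)) :
  tval x = omega w -> class_average w = (S (map_tuple (cell_of a p) x))%:R.
Proof.
move=> xw; set t0 := map_tuple _ x.
have in_ev t : \1_(count_event t) w = (perm_eq t0 t)%:R :> R.
  rewrite indicE; congr (nat_of_bool _)%:R; apply/idP/idP.
    by rewrite inE => /count_eventE; rewrite -xw perm_sym.
  by move=> h; rewrite inE; apply/count_eventE; rewrite -xw perm_sym.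
rewrite /class_average.
set K := #|[pred t' : n.-tuple cell | perm_eq t0 t']|.
rewrite (bigID (fun t : n.-tuple cell => perm_eq t0 t)) /= addrC.
rewrite big1 ?add0r => [|t /negPf nt]; last first.
  by rewrite in_ev nt mulr0.
rewrite (eq_bigr (fun=> (S t0)%:R / K%:R)) => [|t t0t]; last first.
  rewrite in_ev t0t mulr1 (S_perm t0t); congr (_ / _%:R).
  by apply: eq_card => t'; rewrite !inE; have /permPl -> := t0t.
rewrite sumr_const -[LHS]mulr_natr divfK // pnatr_eq0 -lt0n.
by apply/card_gt0P; exists t0; rewrite inE.
Qed.

Lemma class_average_eq0 w : #|` omega w| != n -> class_average w = 0.
Proof.
move=> nw; apply: big1 => t _; rewrite indicE memNset ?mulr0 //.
move=> /count_eventE /perm_size; rewrite size_map size_tuple => h.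
by rewrite -h eqxx in nw.
Qed.

Lemma class_average_ge0 w : 0 <= class_average w.
Proof. by apply: sumr_ge0 => t _; rewrite mulr_ge0 // divr_ge0. Qed.

(** The class size cancels against the one in [prob_count_event], leaving [total_pmf] times the mean
    of [S] over [n] independent uniform cells. *)
Lemma integral_class_average : (\int[P]_w (class_average w)%:E)%E =
  ((\sum_t S t)%:R * total_pmf / #|{: cell}|%:R ^+ n)%:E.
Proof.
under eq_integral => w _ do rewrite -sumEFin.
rewrite ge0_integral_sum //; last first.
  move=> t; apply/measurable_EFinP; apply: measurable_funM => //.
  by apply: measurable_indic; exact: measurable_count_event.
rewrite natr_sum !big_distrl /= -sumEFin; apply: eq_bigr => t _.
under eq_integral => w _ do rewrite EFinM.
rewrite ge0_integralZl //; last first.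
  by apply/measurable_EFinP; apply: measurable_indic; exact: measurable_count_event.
rewrite integral_indic //; last exact: measurable_count_event.
rewrite setIT; transitivity (((S t)%:R /
  #|[pred t' : n.-tuple cell | perm_eq t t']|%:R)%:E * P (count_event t))%E => //.
rewrite prob_count_event -EFinM; congr _%:E.
have : #|[pred t' : n.-tuple cell | perm_eq t t']|%:R != 0 :> R.
  by rewrite pnatr_eq0 -lt0n; apply/card_gt0P; exists t; rewrite inE.
by move=> K0; rewrite (mulrC total_pmf) -!mulrA mulKf.
Qed.

End CountLaw.

(** * Simplices as sets of indices, compared with clustered subsets *)

Section Enumeration.
Context {R : realType} {d n : nat}.
Variables (a eps : R) (k : nat).
Hypotheses (a0 : 0 < a) (eps0 : 0 < eps) (k0 : (0 < k)%N).
Variables (x : n.-tuple (d.-tuple R)) (omega : {fset d.-tuple R}).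
Hypothesis x_omega : tval x = omega.

Definition spans_simplex (A : {set 'I_n}) : Prop :=
  exists2 y, torus a y & forall i, i \in A -> torus_dist a (tnth x i) y < eps.

(** The entries of [x] are distinct, so index sets correspond to vertex sets. [0 < k] makes
    [k.-1.+1] equal to [k] and the vertex sets nonempty. *)
Lemma nb_simplices_card : nb_simplices a eps k omega =
  #|[set A : {set 'I_n} | (#|A| == k) && `[< spans_simplex A >]]%SET|.
Proof.
have x_inj : injective (tnth x).
  by apply/tuple_uniqP; rewrite x_omega fset_uniq.
have x_in i : tnth x i \in omega.
  by rewrite -[_ \in omega]/(_ \in enum_fset omega) -x_omega mem_tnth.
pose f (A : {set 'I_n}) : {fset d.-tuple R} := [fset tnth x i | i in A]%fset.
have fP A i : (tnth x i \in f A) = (i \in A).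
  apply/imfsetP/idP => [[j /= jA /x_inj ->]|iA] //; by exists i.
have f_inj : injective f.
  by move=> A B AB; apply/setP => i; rewrite -!fP AB.
have card_f A : #|` f A| = #|A|.
  by rewrite card_imfset //= -cardE.
rewrite /nb_simplices.
set S := [set A : {set _} | _]%SET.
have -> : simplices k.-1 (cech a eps omega) = [fset s in map f (enum S)]%fset.
  apply/fsetP => s; rewrite [RHS]in_fset 2!inE /= 2!inE /= fpowersetE.
  apply/idP/mapP => /=.
    move=> /andP[/and3P[s_omega _ /asboolP[y hy]] /eqP ks].
    have fA : f [set i | tnth x i \in s]%SET = s.
      apply/fsetP => v; apply/imfsetP/idP => [[i /=]|vs].
        by rewrite inE => ? ->.
      have vx : v \in tval x by rewrite x_omega; exact: (fsubsetP s_omega).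
      have /tnthP[i vi] := vx.
      by exists i => //=; rewrite inE -vi.
    exists [set i | tnth x i \in s]%SET => //.
    rewrite mem_enum inE -card_f fA ks prednK // eqxx; apply/asboolP.
    have /fset0Pn[v vs] : s != fset0 by rewrite -cardfs_gt0 ks.
    by exists y => [|i]; [case: (hy v vs)|rewrite inE => /hy[]].
  move=> [A]; rewrite mem_enum inE => /andP[/eqP kA /asboolP[y ty hy]] ->.
  rewrite card_f kA prednK // eqxx andbT; apply/and3P; split.
  - by apply/fsubsetP => _ /imfsetP[i _ ->].
  - by rewrite -cardfs_gt0 card_f kA.
  - by apply/asboolP; exists y => _ /imfsetP[i /= iA ->]; split => //; exact: hy.
by rewrite card_fseq undup_id ?size_map -?cardE // map_inj_uniq ?enum_uniq.
Qed.

Variable p : nat.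
Hypothesis x_torus : forall i, torus a (tnth x i).

Let cellE j : (fun i => tnth (map_tuple (cell_of a p) x) i j) =1
  (fun i => grid_cell p (mesh a p) (tnth (tnth x i) j)).
Proof. by move=> i; rewrite tnth_map ffunE. Qed.

Lemma card_clustered_le_nb_simplices l : l%:R * mesh a p < 2 * eps ->
  (#|clustered_subsets k l (map_tuple (cell_of a p) x)| <=
    nb_simplices a eps k omega)%N.
Proof.
move=> hl; rewrite nb_simplices_card; apply/subset_leq_card/fintype.subsetP => A.
rewrite !inE => /andP[-> /forallP cl]; apply/asboolP.
have w0 := mesh_gt0 p a0.
(* A sup-norm ball is a product of arcs, so a common point of the balls can be chosen one coordinate
   at a time. *)
have /choice[y hy] j : exists y, 0 <= y < a /\ forall i, i \in A ->
    exists z : int, `|tnth (tnth x i) j - y + z%:~R * a| < eps.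
  have ua i : 0 <= tnth (tnth x i) j < p.+1%:R * mesh a p.
    by rewrite meshE; exact: x_torus.
  have [|y ya hy] := clustered_arc w0 (A := A) ua hl.
    by rewrite -(eq_clustered _ _ (cellE j)).
  by rewrite meshE in ya hy; exists y.
exists [tuple y j | j < d] => [j|i iA]; first by rewrite tnth_mktuple; case: (hy j).
apply/torus_dist_lt => //.
have /choice[m hm] j : exists z : int, `|tnth (tnth x i) j - y j + z%:~R * a| < eps.
  by have [_ /(_ i iA)] := hy j.
by exists m => j; rewrite tnth_mktuple.
Qed.

Lemma nb_simplices_le_card_clustered l : (l <= p.+1)%N ->
  2 * eps + mesh a p <= l%:R * mesh a p ->
  (nb_simplices a eps k omega <=
    #|clustered_subsets k l (map_tuple (cell_of a p) x)|)%N.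
Proof.
move=> lp hl; rewrite nb_simplices_card; apply/subset_leq_card/fintype.subsetP => A.
rewrite !inE => /andP[/eqP Ak /asboolP[y ty hy]]; rewrite Ak eqxx /=.
have w0 := mesh_gt0 p a0.
apply/forallP => j.
have /choice[z hz] i : exists z : int, i \in A ->
    `|tnth (tnth x i) j - tnth y j + z%:~R * a| < eps.
  have [iA|] := boolP (i \in A); last by exists 0.
  by have /torus_dist_lt[//|m hm] := hy i iA; exists (m j) => _; exact: hm.
have ua i : 0 <= tnth (tnth x i) j < p.+1%:R * mesh a p.
  by rewrite meshE; exact: x_torus.
rewrite (eq_clustered _ _ (cellE j)).
apply: (arc_clustered w0 ua (eps := eps) (y := tnth y j) (z := z)) => //.
- by rewrite Ak.
- by rewrite meshE.
Qed.

End Enumeration.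

(** * Bounds for the expectation on a fixed grid *)

Lemma subn_exp_pred_bounds k l : (0 < l)%N ->
  (k * l.-1 ^ k.-1 <= l ^ k - l.-1 ^ k <= k * l ^ k.-1)%N.
Proof.
move=> l0; rewrite subn_exp (_ : l - l.-1 = 1)%N ?mul1n; last first.
  by case: l l0 => // l _; rewrite subSnn.
(* The factored difference is a sum of [k] products of powers of [l] and [l.-1], of total degree
   [k.-1]; both bounds are written as sums of the same shape and compared termwise. *)
have cst m : (k * m ^ k.-1 = \sum_(i < k) m ^ (k.-1 - i) * m ^ i)%N.
  rewrite -[X in (X * _)%N]card_ord -sum_nat_const; apply: eq_bigr => i _.
  by rewrite -expnD subnK //; have := ltn_ord i; lia.
have mono e : (l.-1 ^ e <= l ^ e)%N by case: e => // e; rewrite leq_exp2r ?leq_pred.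
rewrite !cst; apply/andP; split; apply: leq_sum => i _.
  by rewrite leq_mul2r mono ?orbT.
by rewrite leq_mul2l mono ?orbT.
Qed.

Section Expectation.
Context {R : realType} {d : nat} {dO : measure_display} {Omega : measurableType dO}.
Variables (P : probability Omega R) (a lambda eps : R).
Variable (omega : Omega -> {fset d.-tuple R}).
Hypotheses (a0 : 0 < a) (lambda0 : 0 < lambda) (eps0 : 0 < eps).
Hypothesis homega : poisson_process P a lambda omega.
Variables (k n : nat).
Hypothesis k0 : (0 < k)%N.

(** A single point always spans a simplex, since it lies in its own ball. *)
Lemma nb_simplices1 w : nb_simplices a eps 1 (omega w) = #|` omega w|.
Proof.
have x_torus : forall i, torus a (tnth (in_tuple (omega w)) i).
  by move=> i; apply: (pp_torus homega (w := w)); exact: (mem_tnth i (in_tuple (omega w))).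
rewrite (nb_simplices_card a eps _ (x := in_tuple (omega w))) //.
transitivity 'C(#|` omega w|, 1)%N; last by rewrite bin1.
rewrite -[X in 'C(X, _)]card_ord -card_draws; apply: eq_card => A.
rewrite !inE; apply/andb_idr => /cards1P[i ->]; apply/asboolP.
exists (tnth (in_tuple (omega w)) i) => [|j]; first exact: x_torus.
rewrite inE => /eqP ->; apply/torus_dist_lt => //.
by exists (fun=> 0) => m; rewrite subrr mul0r addr0 normr0.
Qed.

Let E := [set w | nb_simplices a eps 1 (omega w) = n].

Lemma prob_nb_simplices1 : P E = (@total_pmf R d a lambda n)%:E.
Proof.
rewrite -(prob_nb_points (s := a) lambda0 homega (A := torus a)) //; last 2 first.
- by rewrite torusE; exact: measurable_box.
- by rewrite torusE lebesgue_tuple_box // ltW.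
congr (P _); apply/seteqP; split => w; rewrite /E /= nb_simplices1 nb_pointsE.
  move=> <-; apply/eqP; rewrite -all_count; apply/allP => x xw.
  by rewrite inE; exact: (pp_torus homega xw).
move=> <-; apply/esym/eqP; rewrite -all_count; apply/allP => x xw.
by rewrite inE; exact: (pp_torus homega xw).
Qed.

Let I := (\int[P]_w ((nb_simplices a eps k (omega w))%:R * \1_E w)%:E)%E.

Variable p : nat.
Local Notation cell := {ffun 'I_d -> 'I_p.+1}.
Local Notation average l := (class_average a omega
  (fun t : n.-tuple cell => #|clustered_subsets k l t|)).

Let S_perm l (t t' : n.-tuple cell) : perm_eq t t' ->
  #|clustered_subsets k l t| = #|clustered_subsets k l t'|.
Proof. exact: card_clustered_subsets_perm. Qed.

Let integral_average l : (l.*2 <= p.+1)%N ->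
  (\int[P]_w (average l w)%:E)%E =
  (@total_pmf R d a lambda n * 'C(n, k)%:R *
   ((l ^ k - l.-1 ^ k)%:R / p.+1%:R ^+ k.-1) ^+ d)%:E.
Proof.
move=> lp; rewrite (integral_class_average a0 lambda0 homega) // sum_card_clustered_subsets //.
congr _%:E; rewrite natrM.
(* For [n < k] the exponents do not add up to [n], but the binomial coefficient vanishes. *)
have [nk|kn] := ltnP n k; first by rewrite bin_small // mulr0 !mul0r.
rewrite [total_pmf _ _ _ * _]mulrC -!mulrA; congr (_ * _).
rewrite mulrCA; congr (_ * _).
rewrite card_ffun !card_ord !natrX -exprM [(d * n)%N]mulnC exprM -expr_div_n; congr (_ ^+ d).
have q0 : p.+1%:R != 0 :> R by rewrite pnatr_eq0.
have -> : p.+1%:R ^+ n = p.+1%:R * p.+1%:R ^+ k.-1 * p.+1%:R ^+ (n - k) :> R.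
  by rewrite -exprS prednK // -exprD subnKC.
rewrite !natrM natrX.
have q1 : p.+1%:R ^+ k.-1 != 0 :> R by rewrite expf_neq0.
have q2 : p.+1%:R ^+ (n - k) != 0 :> R by rewrite expf_neq0.
move: (p.+1%:R ^+ k.-1) (p.+1%:R ^+ (n - k)) q1 q2 => u v u0 v0.
move: (p.+1%:R : R) q0 => q q0.
by field; rewrite q0 u0 v0.
Qed.

Let tuple_of_points w : #|` omega w| = n ->
  {x : n.-tuple (d.-tuple R) | tval x = omega w}.
Proof. by move=> /eqP h; exists (Tuple h). Qed.

Let indicE1 w : \1_E w = (#|` omega w| == n)%:R :> R.
Proof.
rewrite indicE; congr (nat_of_bool _)%:R.
by apply/idP/eqP; rewrite inE /E /= nb_simplices1.
Qed.

Let tnth_torus w (x : n.-tuple (d.-tuple R)) : tval x = omega w ->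
  forall i, torus a (tnth x i).
Proof.
move=> xw i; apply: (pp_torus homega (w := w)).
by rewrite /= -[_ \in _]/(_ \in enum_fset (omega w)) -xw mem_tnth.
Qed.

(** On [E] the class average counts the clustered subsets of the actual cells, each of which spans a
    simplex; off [E] both integrands vanish. *)
Lemma integral_lower_bound l : (l.*2 <= p.+1)%N -> l%:R * mesh a p < 2 * eps ->
  ((@total_pmf R d a lambda n * 'C(n, k)%:R *
   ((l ^ k - l.-1 ^ k)%:R / p.+1%:R ^+ k.-1) ^+ d)%:E <= I)%E.
Proof.
move=> lp hl; rewrite -integral_average //; apply: le_integral_nonmeasurable => w.
  by rewrite lee_fin class_average_ge0.
rewrite lee_fin indicE1; case: (eqVneq #|` omega w| n) => nw.
  have [x xw] := tuple_of_points nw.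
  rewrite (class_average_tuple homega (@S_perm l) xw) mulr1 ler_nat.
  by apply: (card_clustered_le_nb_simplices a0 eps0 k0 xw) => //; exact: tnth_torus xw.
by rewrite (class_average_eq0 homega) // mulr0.
Qed.

Lemma integral_upper_bound l : (l.*2 <= p.+1)%N ->
  2 * eps + mesh a p <= l%:R * mesh a p ->
  (I <= (@total_pmf R d a lambda n * 'C(n, k)%:R *
   ((l ^ k - l.-1 ^ k)%:R / p.+1%:R ^+ k.-1) ^+ d)%:E)%E.
Proof.
move=> lp hl; rewrite -integral_average //; apply: le_integral_nonmeasurable => w.
  by rewrite lee_fin mulr_ge0.
rewrite lee_fin indicE1; case: (eqVneq #|` omega w| n) => nw.
  have [x xw] := tuple_of_points nw.
  rewrite (class_average_tuple homega (@S_perm l) xw) mulr1 ler_nat.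
  apply: (nb_simplices_le_card_clustered a0 eps0 k0 xw) => //; last by lia.
  exact: tnth_torus xw.
by rewrite mulr0 class_average_ge0.
Qed.

End Expectation.

(** * Refinement of the grid and passage to the limit *)

Lemma cluster_fraction_bounds (R : realType) d k l q :
  (0 < k)%N -> (0 < l)%N -> (0 < q)%N ->
  (k%:R * (l.-1%:R / q%:R) ^+ k.-1) ^+ d <=
    ((l ^ k - l.-1 ^ k)%:R / q%:R ^+ k.-1) ^+ d :> R /\
  ((l ^ k - l.-1 ^ k)%:R / q%:R ^+ k.-1) ^+ d <=
    (k%:R * (l%:R / q%:R) ^+ k.-1) ^+ d :> R.
Proof.
move=> k0 l0 q0; have /andP[h1 h2] := subn_exp_pred_bounds k l0.
have qk : 0 < q%:R ^+ k.-1 :> R by rewrite exprn_gt0 // ltr0n.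
have ge0 m : 0 <= k%:R * (m%:R / q%:R) ^+ k.-1 :> R.
  by rewrite mulr_ge0 // exprn_ge0 // divr_ge0.
have D0 : 0 <= (l ^ k - l.-1 ^ k)%:R / q%:R ^+ k.-1 :> R by rewrite divr_ge0 // ltW.
by split; apply: lerXn2r; rewrite ?nnegrE ?ge0 ?D0 //
    expr_div_n mulrA ler_pM2r ?invr_gt0 // -natrX -natrM ler_nat.
Qed.

Theorem corollary10 (R : realType) (d : nat) (hd : (1 <= d)%N)
    (a lambda eps : R) (ha : 0 < a) (hlambda : 0 < lambda)
    (heps : 0 < eps) (heps_a : eps < a / 4)
    (dO : measure_display) (Omega : measurableType dO)
    (P : probability Omega R) (omega : Omega -> {fset d.-tuple R})
    (homega : poisson_process P a lambda omega)
    (k : nat) (hk : (1 <= k)%N) (n : nat) :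
  cond_expectation P (fun w => (nb_simplices a eps k (omega w))%:R)
    [set w | nb_simplices a eps 1 (omega w) = n] =
  ('C(n, k)%:R * k%:R ^+ d * (2 * eps / a) ^+ (d * (k - 1)))%:E.
Proof.
pose b := 2 * eps / a; pose c := @total_pmf R d a lambda n * 'C(n, k)%:R.
have b0 : 0 < b by rewrite !mulr_gt0 // invr_gt0.
have b_half : b < 1 / 2 by rewrite ltr_pdivrMr //; lra.
have T0 : 0 < @total_pmf R d a lambda n by exact: total_pmf_gt0.
have c0 : 0 <= c by rewrite mulr_ge0 // ltW.
(* Both bounds become values of [F] at ratios close to [b], and [F b] is [total_pmf] times the
   claimed value. *)
pose F (t : R) := c * (k%:R * t ^+ k.-1) ^+ d.
have F_le s t : 0 <= s -> s <= t -> F s <= F t.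
  move=> s0 st; have t0 := le_trans s0 st.
  rewrite /F ler_wpM2l // lerXn2r ?nnegrE ?mulr_ge0 ?exprn_ge0 //.
  by rewrite ler_wpM2l // lerXn2r.
rewrite /cond_expectation unlock (prob_nb_simplices1 ha hlambda heps homega).
set I := (\int[P]_w _)%E.
(* With [t] the integer part of [b * q], the lower bound takes [l = t - 1] and involves
   [l - 1 = t - 2 > b * q - 3]; the upper bound takes [l = t + 2 <= b * q + 2]. A margin of [3 / q]
   thus serves on both sides. *)
have bounds : \forall p \near \oo,
    ((F (b - 3 / p.+1%:R))%:E <= I <= (F (b + 3 / p.+1%:R))%:E)%E.
  have hb : 0 < 1 - 2 * b by lra.
  near=> p; pose q : R := p.+1%:R.
  have q0 : 0 < q by rewrite ltr0n.
  have pq : p%:R <= q by rewrite ler_nat.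
  (* This makes [b - 3 / q] nonnegative, as the monotonicity of [F] requires, and forces [t > 2]. *)
  have bq : 3 <= b * q.
    rewrite mulrC -ler_pdivrMr //; apply: le_trans pq; near: p.
    exact: nbhs_infty_ger.
  (* Here [eps < a / 4] enters: it yields [2 * (t + 2) <= q], the condition for a unique first
     cell. *)
  have bq2 : 4 <= (1 - 2 * b) * q.
    rewrite mulrC -ler_pdivrMr //; apply: le_trans pq; near: p.
    exact: nbhs_infty_ger.
  rewrite mulrBl mul1r -mulrA in bq2.
  have := truncn_itv (ltW (mulr_gt0 b0 q0)).
  set t := Num.truncn _ => /andP[t1 t2]; rewrite -natr1 in t2.
  have t3 : (2 < t)%N by rewrite -(ltr_nat R); lra.
  have meshq x : x * mesh a p = x / q * a by rewrite /mesh mulrA mulrAC.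
  have epsb : 2 * eps = b * a by rewrite /b divfK ?gt_eqF.
  have nat2 m : m.*2%:R = 2 * m%:R :> R by rewrite -muln2 natrM mulrC.
  have t0 : t.-1%:R = t%:R - 1 :> R.
    by rewrite -[X in X%:R - 1](prednK (ltn_trans _ t3)) // -natr1 addrK.
  have t00 : t.-1.-1%:R = t%:R - 2 :> R.
    have e : (t.-1.-1 + 2)%N = t by clear - t3; lia.
    by rewrite -[in RHS]e natrD addrK.
  have l1 : (t.-1.*2 <= p.+1)%N by rewrite -(ler_nat R) nat2 t0 -/q; lra.
  have l2 : (t.+2.*2 <= p.+1)%N by rewrite -(ler_nat R) nat2 -!natr1 -/q; lra.
  have t2' : (0 < t.-1)%N by rewrite -ltnS prednK // (ltn_trans _ t3).
  have [lo _] := @cluster_fraction_bounds R d k t.-1 p.+1 hk t2' isT.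
  have [_ up] := @cluster_fraction_bounds R d k t.+2 p.+1 hk isT isT.
  apply/andP; split.
    apply: le_trans (integral_lower_bound ha hlambda heps homega n hk l1 _).
      rewrite lee_fin -/c; apply: le_trans (ler_wpM2l c0 lo).
      apply: F_le; first by rewrite subr_ge0 ler_pdivrMr.
      by rewrite t00 -/q lerBlDr -mulrDl ler_pdivlMr //; lra.
    rewrite meshq epsb ltr_pM2r // ltr_pdivrMr // t0; lra.
  apply: le_trans (integral_upper_bound ha hlambda heps homega n hk l2 _) _.
    (* [t + 2] exceeds [b * q + 1], which leaves room for the one extra cell due to rounding. *)
    have -> : mesh a p = 1 / q * a by rewrite -meshq mul1r.
    rewrite mulrA epsb mulrA mulr1 -mulrDl ler_pM2r // -lerBrDr mul1r.
    by rewrite -[X in _ - X]mul1r -mulrBl ler_pdivlMr // -!natr1; lra.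
  rewrite lee_fin -/c; apply: le_trans (ler_wpM2l c0 up) _.
  apply: F_le; first by rewrite divr_ge0.
  by rewrite -/q -lerBlDr -mulrBl ler_pdivrMr // -!natr1; lra.
(* One instance of the bounds shows that [I] is finite, so the squeeze can take place in [R]. *)
have [v Iv] : exists v, I = v%:E.
  have [p _ /(_ p (leqnn p)) {bounds}] := bounds.
  by case: I => [v _|/andP[]|/andP[]] //; exists v.
have vE : v = F b.
  have harm (s : R) : (fun p => b + s / p.+1%:R) @ \oo --> b.
    rewrite -[X in _ --> X]addr0; apply: cvgD; first exact: cvg_cst.
    rewrite -[X in _ --> X](mulr0 s); apply: cvgM; first exact: cvg_cst.
    exact: cvg_harmonic.
  have Fcvg (s : R) : (fun p => F (b + s / p.+1%:R)) @ \oo --> F b.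
    apply: cvgM; first exact: cvg_cst.
    apply: (cvg_comp (fun p => k%:R * (b + s / p.+1%:R) ^+ k.-1)
      (fun x => x ^+ d)); last exact: exprn_continuous.
    apply: cvgM; first exact: cvg_cst.
    by apply: (cvg_comp _ (fun x => x ^+ k.-1) (harm s)); exact: exprn_continuous.
  apply/le_anti/andP; split.
    apply: (ler_cvg_to (cvg_cst v) (Fcvg 3)).
    by apply: filterS bounds => p /andP[_]; rewrite Iv lee_fin.
  apply: (ler_cvg_to (Fcvg (- 3)) (cvg_cst v)).
  by apply: filterS bounds => p /andP[+ _]; rewrite Iv lee_fin mulNr.
rewrite Iv inver gt_eqF // -EFinM vE /F /c; congr _%:E.
rewrite -[_ * 'C(n, k)%:R * _]mulrA [total_pmf _ _ _ * _]mulrC mulfK ?gt_eqF //.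
by rewrite exprMn -exprM [(k.-1 * d)%N]mulnC subn1 mulrA.
Unshelve. all: by end_near.
Qed.
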